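(* Let $I\subseteq S=\Bbbk[x_1,\ldots,x_n]$ be a monomial ideal over a field $\Bbbk$. If $\mathbf a\in\mathbb Z^n$ and $\mathbf 1=(1,\ldots,1)$, then the dual Čech simplicial complex $\check{C}\Delta^{-\mathbf a-\mathbf 1}$ of $I$ is Alexander dual to the Čech simplicial complex $\check{C}\Delta_{\mathbf a}$ of $I$ inside of the simplex on $\{1,\ldots,n\}\smallsetminus\mathrm{supp}(\mathbf a_-)$.
   Context: For $\mathbf b\in\mathbb Z^n$, $\mathrm{supp}(\mathbf b)=\{i\mid b_i\neq0\}$ and $\mathbf b=\mathbf b_+-\mathbf b_-$ is the decomposition into positive and negative parts, with $\mathbf b_+,\mathbf b_-\in\mathbb N^n$ having disjoint supports. For $F\subseteq\{1,\ldots,n\}$, $S_F=S[x_i^{-1}\mid i\in F]$ with its natural $\mathbb Z^n$-grading. The Čech simplicial complex of $I$ in degree $\mathbf a\in\mathbb Z^n$ is $$\check{C}\Delta_{\mathbf a}=\{F\smallsetminus\mathrm{supp}(\mathbf a_-)\mid F\subseteq\{1,\ldots,n\},\ (S_F/IS_F)_{\mathbf a}=\Bbbk\},$$ where $(S_F/IS_F)_{\mathbf a}=\Bbbk$ means that the degree-$\mathbf a$ piece is nonzero (which forces $F\supseteq\mathrm{supp}(\mathbf a_-)$). Let $\overline\Lambda_I\subseteq\mathbb N^n$ be the set of exponent vectors of the monomials in $I$. The dual Čech simplicial complex for $\mathbf a\in\mathbb Z^n$ is $$\check{C}\Delta^{\mathbf a}=\{F\subseteq\{1,\ldots,n\}\mid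 F=\mathrm{supp}(\mathbf b_-)\text{ for some }\mathbf b\in\mathbf a+\overline\Lambda_I\}.$$ Two simplicial complexes $\Delta,\Delta^*$ whose faces are subsets of a finite set $\sigma$ are Alexander dual inside the simplex on $\sigma$ if for all $G\subseteq\sigma$: $G\notin\Delta$ if and only if $\sigma\smallsetminus G\in\Delta^*$. Void complexes (having no faces at all) are allowed. *)

(* Defs.v *)
From HB Require Import structures.
From mathcomp Require Import all_boot all_order all_algebra.
From mathcomp.multinomials Require Import mpoly.

Set Implicit Arguments.
Unset Strict Implicit.
Unset Printing Implicit Defensive.

Import Order.TTheory GRing.Theory Num.Theory.

Local Open Scope ring_scope.

(** Degrees: [Z^n] is [{ffun 'I_n -> int}] and [N^n] is ['X_{1..n}]. *)

Definition posp (n : nat) (b : {ffun 'I_n -> int}) : {ffun 'I_n -> int} :=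
  [ffun i => Num.max (b i) 0].

Definition negp (n : nat) (b : {ffun 'I_n -> int}) : {ffun 'I_n -> int} :=
  [ffun i => Num.max (- b i) 0].

Definition supp (n : nat) (b : {ffun 'I_n -> int}) : {set 'I_n} :=
  [set i | b i != 0].

Lemma pospB_negp (n : nat) (b : {ffun 'I_n -> int}) : b = posp b - negp b.
Proof.
apply/ffunP => i; rewrite !ffunE.
have [b0|b0] := leP (b i) 0.
  by rewrite max_l ?oppr_ge0 // sub0r opprK.
by rewrite max_r ?subr0 // oppr_le0 ltW.
Qed.

Lemma supp_posp_negp (n : nat) (b : {ffun 'I_n -> int}) :
  [disjoint supp (posp b) & supp (negp b)].
Proof.
rewrite -setI_eq0; apply/eqP/setP => i; rewrite !inE !ffunE.
have [b0|b0] := leP (b i) 0; first by rewrite eqxx.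
by rewrite [Num.max (- _) _]max_r ?eqxx ?andbF // oppr_le0 ltW.
Qed.

Definition zvec (n : nat) (m : 'X_{1..n}) : {ffun 'I_n -> int} :=
  [ffun i => (m i)%:Z].

(** Ideals are [Prop]-valued predicates: the [idealr] structure of
    [ring_quotient] is boolean and excludes the unit ideal. *)

(* The ideal generated by [A] in the subring [T] of [R]
   (an ideal of [T] when [A] is contained in [T]). *)
Definition ideal_gen (R : comNzRingType) (T A : R -> Prop) (x : R) : Prop :=
  exists s : seq (R * R),
    (forall p, p \in s -> T p.1 /\ A p.2) /\ x = \sum_(p <- s) p.1 * p.2.

Definition monomial_ideal (n : nat) (k : fieldType)
    (I : {mpoly k[n]} -> Prop) : Prop :=
  exists A : 'X_{1..n} -> Prop, forall f : {mpoly k[n]},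
    I f <-> ideal_gen (fun=> True) (fun g => exists2 m, A m & g = 'X_[m]) f.

Definition exponents (n : nat) (k : fieldType) (I : {mpoly k[n]} -> Prop)
  (m : 'X_{1..n}) : Prop := I 'X_[m].

(** The localizations [S_F] of the domain [S = {mpoly k[n]}] are realized as
    subrings of its fraction field. *)

Definition loc (n : nat) (k : fieldType) (F : {set 'I_n})
    (u : {fraction {mpoly k[n]}}) : Prop :=
  exists (f : {mpoly k[n]}) (m : 'X_{1..n}),
    supp (zvec m) \subset F /\ u = tofrac f / tofrac 'X_[m].

Definition laurent_monomial (n : nat) (k : fieldType)
    (a : {ffun 'I_n -> int}) : {fraction {mpoly k[n]}} :=
  \prod_(i < n) (tofrac 'X_i) ^ (a i).

Definition loc_deg (n : nat) (k : fieldType) (F : {set 'I_n})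
    (a : {ffun 'I_n -> int}) (u : {fraction {mpoly k[n]}}) : Prop :=
  loc F u /\ exists c : k, u = tofrac c%:MP * laurent_monomial k a.

Definition loc_ideal (n : nat) (k : fieldType) (I : {mpoly k[n]} -> Prop)
    (F : {set 'I_n}) : {fraction {mpoly k[n]}} -> Prop :=
  ideal_gen (@loc n k F) (fun v => exists2 f, I f & v = tofrac f).

(* The degree-[a] piece of [S_F / I S_F] is the image of that of [S_F]; it is
   nonzero iff some element of the latter lies outside [I S_F]. *)
Definition quot_deg_neq0 (n : nat) (k : fieldType) (I : {mpoly k[n]} -> Prop)
    (F : {set 'I_n}) (a : {ffun 'I_n -> int}) : Prop :=
  exists2 u, loc_deg F a u & ~ loc_ideal I F u.

(** Collections of faces are [Prop]-valued predicates on [{set 'I_n}]; the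
    empty one is the void complex. *)

Definition cech (n : nat) (k : fieldType) (I : {mpoly k[n]} -> Prop)
    (a : {ffun 'I_n -> int}) (G : {set 'I_n}) : Prop :=
  exists2 F : {set 'I_n}, quot_deg_neq0 I F a & G = F :\: supp (negp a).

Definition dual_cech (n : nat) (k : fieldType) (I : {mpoly k[n]} -> Prop)
    (a : {ffun 'I_n -> int}) (F : {set 'I_n}) : Prop :=
  exists b : {ffun 'I_n -> int},
    (exists2 m, exponents I m & b = a + zvec m) /\ F = supp (negp b).

Definition simplicial_complex_on (T : finType) (sigma : {set T})
    (Delta : {set T} -> Prop) : Prop :=
  (forall G, Delta G -> G \subset sigma) /\
  (forall G H : {set T}, H \subset G -> Delta G -> Delta H).

Definition alexander_dual (T : finType) (sigma : {set T})
    (Delta Delta' : {set T} -> Prop) : Prop :=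
  [/\ simplicial_complex_on sigma Delta,
      simplicial_complex_on sigma Delta' &
      forall G : {set T}, G \subset sigma -> (~ Delta G <-> Delta' (sigma :\: G))].

(* Main.v *)
Require Import Defs.
From mathcomp Require Import all_boot all_order all_algebra.
From mathcomp Require Import ring zify.
From mathcomp.multinomials Require Import mpoly.

Import Order.TTheory GRing.Theory Num.Theory.
Local Open Scope ring_scope.

(** Both complexes are determined by the exponents [m] of [I]. The faces of the
    dual complex in degree [-a-1] are the sets [{i | m_i <= a_i}]. On the other
    side, [S_F / I S_F] is nonzero in degree [a] iff [F] contains [supp a_-] and
    no [m] satisfies [m_i <= a_i] for all [i] outside [F]: indeed [x^a] lies in
    [I S_F] iff some [x^m] in [I] divides it in [S_F]. Raising coordinates of
    [m] shows that the sets [{i | m_i <= a_i}] are closed under passing to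
    subsets, which gives the duality. *)

Lemma ideal_gen0 (R : comNzRingType) (T A : R -> Prop) : ideal_gen T A 0.
Proof. by exists [::]; rewrite big_nil. Qed.

Lemma ideal_genD (R : comNzRingType) (T A : R -> Prop) (x y : R) :
  ideal_gen T A x -> ideal_gen T A y -> ideal_gen T A (x + y).
Proof.
move=> [s [sTA ->]] [t [tTA ->]]; exists (s ++ t); rewrite big_cat; split=> // p.
by rewrite mem_cat => /orP[/sTA|/tTA].
Qed.

Lemma ideal_genM (R : comNzRingType) (A : R -> Prop) (x y : R) :
  ideal_gen (fun=> True) A y -> ideal_gen (fun=> True) A (x * y).
Proof.
move=> [s [sA ->]]; exists [seq (x * p.1, p.2) | p <- s]; split.
  by move=> _ /mapP[p /sA[_ Ap] ->].
by rewrite big_map mulr_sumr; apply: eq_bigr => p _; rewrite mulrA.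
Qed.

Section Monomials.
Variables (n : nat) (k : fieldType).
Implicit Types (a : {ffun 'I_n -> int}) (F : {set 'I_n}) (m p q : 'X_{1..n}).
Local Notation X m := (tofrac ('X_[m] : {mpoly k[n]})).

(** Having $a_+$ and $a_-$ as exponents in $\mathbb N^n$ lets $x^a$ be handled as a quotient of two
    monomials of $S$. *)
Definition posm a : 'X_{1..n} := [multinom `|posp a i|%N | i < n].
Definition negm a : 'X_{1..n} := [multinom `|negp a i|%N | i < n].

Lemma posmB_negm a i : a i = (posm a i)%:Z - (negm a i)%:Z.
Proof. by rewrite !mnmE !ffunE; lia. Qed.

Lemma supp_zvec_negm a : supp (zvec (negm a)) = supp (negp a).
Proof. by apply/setP => i; rewrite !inE !ffunE mnmE ffunE; lia. Qed.

Lemma mem_supp_negp a i : (i \in supp (negp a)) = (a i < 0).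
Proof. by rewrite inE ffunE; lia. Qed.

Lemma tofracX_neq0 m : X m != 0.
Proof.
rewrite tofrac_eq0; apply/eqP => /(congr1 (mcoeff m)).
by rewrite mcoeffX eqxx mcoeff0 => /eqP; rewrite oner_eq0.
Qed.

Lemma tofracXD p q : X (p + q)%MM = X p * X q.
Proof. by rewrite mpolyXD rmorphM. Qed.

Lemma laurent_monomialE a p q : (forall i, a i = (p i)%:Z - (q i)%:Z) ->
  laurent_monomial k a = X p / X q.
Proof.
move=> apq; rewrite /laurent_monomial !mpolyXE_id !rmorph_prod /= -prodf_div.
apply: eq_bigr => i _; rewrite apq !rmorphXn /=.
by rewrite expfzDr ?tofracX_neq0 // -exprnN.
Qed.

Lemma loc_laurent_monomial F a :
  supp (negp a) \subset F -> loc F (laurent_monomial k a).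
Proof.
move=> aF; exists 'X_[posm a], (negm a); rewrite supp_zvec_negm; split=> //.
exact: laurent_monomialE (posmB_negm a).
Qed.

Lemma locCM F (c : k) u : loc F u -> loc F (tofrac c%:MP * u).
Proof.
by move=> [f [m [mF ->]]]; exists (c%:MP * f), m; rewrite rmorphM mulrA.
Qed.

(** Clearing denominators in $c x^a = f/x^m$ gives $c x^{a_+ + m} = f x^{a_-}$, so $a_- \le a_+ +
    m$. Where $a_i < 0$ the entry of $a_+$ is zero, so $m_i > 0$ and $i \in F$. *)
Lemma loc_laurent_monomial_supp F a (c : k) : c != 0 ->
  loc F (tofrac c%:MP * laurent_monomial k a) -> supp (negp a) \subset F.
Proof.
move=> c0 [f [m [mF]]]; rewrite (laurent_monomialE _ _ _ (posmB_negm a)) => eqf.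
have {eqf} /eqP : tofrac (c%:MP * 'X_[posm a + m]) = tofrac (f * 'X_[negm a]).
  rewrite !rmorphM /= tofracXD.
  apply: (mulIf (invr_neq0 (tofracX_neq0 (negm a)))).
  rewrite mulfK ?tofracX_neq0 // -(mulfVK (tofracX_neq0 m) (tofrac f)) -eqf.
  by ring.
rewrite tofrac_eq => /eqP /(congr1 (mcoeff (posm a + m)%MM)).
rewrite mcoeffCM mcoeffX eqxx mulr1 => eqc.
(* The coefficient there is $c \ne 0$, and the exponents of $f x^{a_-}$ are those of $f$ shifted by
   $a_-$. *)
have /mapP[r _ eq_am] : (posm a + m)%MM \in [seq (negm a + r)%MM | r <- msupp f].
  by rewrite -(perm_mem (msuppMX f (negm a))) mcoeff_msupp -eqc.
apply/subsetP => i; rewrite mem_supp_negp => ai.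
apply: (subsetP mF); rewrite inE ffunE.
move/(congr1 (fun p : 'X_{1..n} => p i)): eq_am.
by rewrite !mnmDE !mnmE !ffunE; lia.
Qed.

Variable I : {mpoly k[n]} -> Prop.
Hypothesis I0 : I 0.
Hypothesis ID : forall f g, I f -> I g -> I (f + g).
Hypothesis IM : forall f g, I g -> I (f * g).

Lemma loc_ideal_clear_denom F u : loc_ideal I F u ->
  exists f m, [/\ I f, supp (zvec m) \subset F & u * X m = tofrac f].
Proof.
move=> [s []]; elim: s u => [|p s IHs] u sI ->.
  by exists 0, 0%MM; rewrite big_nil mul0r rmorph0; split=> //;
    apply/subsetP => i; rewrite inE ffunE mnm0E.
have [|f [m [If mF eqf]]] := IHs _ _ erefl.
  by move=> q qs; apply: sI; rewrite inE qs orbT.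
have [[g [q [qF eqp1]]] [h Ih eqp2]] := sI p (mem_head p s).
(* The sum $(g/x^q) h + f/x^m$ is put over the common denominator $x^{m+q}$. *)
exists (g * 'X_[m] * h + f * 'X_[q]), (m + q)%MM; split.
- by apply: ID; [exact: IM | rewrite mulrC; exact: IM].
- apply/subsetP => i; rewrite inE ffunE mnmDE.
  case: (posnP (m i)) => [mi0 mqi|mi _].
    by apply: (subsetP qF); rewrite inE ffunE; lia.
  by apply: (subsetP mF); rewrite inE ffunE; lia.
- rewrite big_cons eqp1 eqp2 !(rmorphM, rmorphD) /= -eqf tofracXD.
  move: (tofracX_neq0 q) => q0.
  by rewrite mulrDl -[in RHS](mulfVK q0 (tofrac g)); ring.
Qed.

Lemma quot_deg_neq0P F a : quot_deg_neq0 I F a <->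
  supp (negp a) \subset F /\
  ~ exists2 m, exponents I m & forall i, i \notin F -> (m i)%:Z <= a i.
Proof.
split.
  move=> [u [Fu [c eqc]] uI].
  have c0 : c != 0.
    by apply/eqP => c0; apply: uI; rewrite eqc c0 mpolyC0 rmorph0 mul0r;
      exact: ideal_gen0.
  split; first by apply: (loc_laurent_monomial_supp _ _ _ c0); rewrite -eqc.
  move=> [m Im ma]; apply: uI.
  (* A single term suffices: $c x^a = (c x^{a-m}) x^m$, and $x^{a-m}$ lies in $S_F$ because $a - m$
     is negative only inside $F$. *)
  exists [:: (tofrac c%:MP * laurent_monomial k (a - zvec m), X m)]; split.
    move=> p; rewrite inE => /eqP -> /=; split; last by exists 'X_[m].
    apply: locCM; apply: loc_laurent_monomial.
    apply/subsetP => i; rewrite mem_supp_negp !ffunE => ai.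
    by apply: contraTT ai => /ma; rewrite subr_lt0 -leNgt.
  rewrite big_seq1 eqc /= -mulrA; congr (_ * _).
  rewrite (laurent_monomialE _ _ _ (posmB_negm (a - zvec m))).
  rewrite (laurent_monomialE a (posm (a - zvec m)%R + m)%MM (negm (a - zvec m))).
    by rewrite tofracXD mulrAC.
  move=> i; apply: (addIr (- (m i)%:Z)).
  by rewrite mnmDE PoszD addrAC addrK -posmB_negm !ffunE.
move=> [aF no_m]; exists (laurent_monomial k a).
  split; first exact: loc_laurent_monomial.
  by exists 1; rewrite mpolyC1 rmorph1 mul1r.
move=> /loc_ideal_clear_denom[f [m [If mF]]].
rewrite (laurent_monomialE _ _ _ (posmB_negm a)) => eqf; apply: no_m.
(* From $x^a x^m = f \in I$ it follows that $x^{a_+ + m} = x^{a_-} f \in I$. Outside $F$, $m$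
   vanishes and $a \ge 0$, so this exponent agrees with $a$ there. *)
exists (posm a + m)%MM.
  rewrite /exponents; suff -> : 'X_[posm a + m] = 'X_[negm a] * f by exact: IM.
  apply/eqP; rewrite -tofrac_eq tofracXD rmorphM /= -eqf.
  by apply/eqP; rewrite mulrA mulrCA divff ?tofracX_neq0 // mulr1.
move=> i iF.
have : i \notin supp (negp a) by apply: contra iF; exact: (subsetP aF).
have : i \notin supp (zvec m) by apply: contra iF; exact: (subsetP mF).
by rewrite mem_supp_negp inE ffunE mnmDE !mnmE !ffunE; lia.
Qed.

(** Since $F$ must contain the support of $a_-$, it is recovered from the face $G$ as the union of
    that support with $G$. *)
Lemma cechP a (G : {set 'I_n}) : cech I a G <->
  G \subset ~: supp (negp a) /\
  ~ exists2 m, exponents I m &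
      forall i, i \notin supp (negp a) :|: G -> (m i)%:Z <= a i.
Proof.
split.
  move=> [F /quot_deg_neq0P[aF no_m] ->]; split.
    by rewrite setDE subsetIr.
  by rewrite -{1}(setIidPr aF) setID.
move=> [Ga no_m]; exists (supp (negp a) :|: G).
  by apply/quot_deg_neq0P; rewrite subsetUl.
by rewrite setDUl setDv set0U; apply/esym/setDidPl; rewrite disjoints_subset.
Qed.

Lemma dual_cechP a (G : {set 'I_n}) : dual_cech I (- a - [ffun=> 1]) G <->
  exists2 m, exponents I m & G = [set i | (m i)%:Z <= a i].
Proof.
have suppE m :
    supp (negp (- a - [ffun=> 1] + zvec m)) = [set i | (m i)%:Z <= a i].
  apply/setP => i; rewrite mem_supp_negp inE !ffunE.
  (* This is where the shift by $\mathbf 1$ acts: over the integers, $m_i < a_i + 1$ iff $m_i \le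
     a_i$. *)
  by rewrite -opprD addrC subr_lt0 ltzD1.
split=> [[_ [[m Im ->] ->]]|[m Im ->]]; first by exists m.
by exists (- a - [ffun=> 1] + zvec m); split; [exists m | ].
Qed.

Lemma exponents_le_subset a m (G : {set 'I_n}) : exponents I m ->
  G \subset [set i | (m i)%:Z <= a i] ->
  exists2 m', exponents I m' & G = [set i | (m' i)%:Z <= a i].
Proof.
move=> Im /subsetP Gm.
(* Adding $|a_i| + 1$ pushes each coordinate outside $G$ above $a_i$; those in $G$ stay
   unchanged. *)
pose r := [multinom if i \in G then 0%N else `|a i|.+1 | i < n].
exists (r + m)%MM; first by rewrite /exponents mpolyXD; exact: IM.
apply/setP => i; rewrite inE mnmDE mnmE.
have [/Gm|iG] := boolP (i \in G); first by rewrite inE add0n => ->.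
lia.
Qed.

End Monomials.

Theorem theorem6p3 (n : nat) (k : fieldType) (I : {mpoly k[n]} -> Prop)
    (a : {ffun 'I_n -> int}) :
  monomial_ideal I ->
  alexander_dual (~: supp (negp a))
    (dual_cech I (- a - [ffun=> 1])) (cech I a).
Proof.
move=> [A IA].
have I0 : I 0 by apply/IA; exact: ideal_gen0.
have ID f g : I f -> I g -> I (f + g).
  by move=> /IA If /IA Ig; apply/IA; exact: ideal_genD.
have IM f g : I g -> I (f * g) by move=> /IA Ig; apply/IA; exact: ideal_genM.
have cechE := cechP n k I I0 ID IM a.
have dualE := dual_cechP n k I a.
split.
- split=> [G /dualE[m _ ->]|G H HG /dualE[m Im eqG]].
    (* As $m_i \ge 0$, $m_i \le a_i$ forces $a_i \ge 0$. *)
    by apply/subsetP => i; rewrite !inE ffunE; lia.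
  by apply/dualE; apply: exponents_le_subset Im _; rewrite -?eqG.
- split=> [G /cechE[]//|G H HG /cechE[Ga no_m]].
  apply/cechE; split; first exact: subset_trans Ga.
  move=> [m Im mH]; apply: no_m; exists m => // i iG.
  by apply: mH; apply: contra iG; apply/subsetP/setUS.
- move=> G Ga.
  (* With this, the condition of [cechP] on the complementary face becomes $m_i \le a_i$ for all $i
     \in G$. *)
  have coverE : supp (negp a) :|: (~: supp (negp a) :\: G) = ~: G.
    apply/setP => i; move/subsetP/(_ i): Ga; rewrite !inE.
    by case: (i \in G) => [/(_ isT)/negPf->|_]; rewrite ?orbN.
  have leG m : (forall i, i \notin ~: G -> (m i)%:Z <= a i) <->
      G \subset [set i | (m i)%:Z <= a i].
    split=> [mG|/subsetP mG i]; last by rewrite inE negbK => /mG; rewrite inE.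
    by apply/subsetP => i iG; rewrite inE; apply: mG; rewrite inE iG.
  split=> [no_G|/cechE[_ no_m] /dualE[m Im eqG]].
    apply/cechE; rewrite coverE subsetDl; split=> // -[m Im /leG Gm].
    by apply/no_G/dualE; exact: exponents_le_subset Im Gm.
  by apply: no_m; rewrite coverE; exists m => //; apply/leG; rewrite -eqG.
Qed.
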